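(* Let $\alpha=(\alpha_n)_{n\in\mathbb{N}}$ be any sequence with $\alpha_n\uparrow\infty$. (i) Suppose that $\Lambda_0(\alpha)$ is nuclear. Then $$\sigma(\mathsf{C};\Lambda_0(\alpha))=\sigma_{pt}(\mathsf{C};\Lambda_0(\alpha))=\Sigma.$$ (ii) If, in addition to $\Lambda_0(\alpha)$ being nuclear, also $v(\alpha)>0$, then $$\sigma^*(\mathsf{C};\Lambda_0(\alpha))=\overline{\sigma(\mathsf{C};\Lambda_0(\alpha))}=\Sigma_0.$$
   Context: Notation: $\mathbb{N}=\{1,2,3,\ldots\}$. The notation $\alpha_n\uparrow\infty$ means that $\alpha=(\alpha_n)_{n\in\mathbb{N}}\subseteq(1,\infty)$ satisfies $\alpha_n<\alpha_{n+1}$ for all $n\in\mathbb{N}$ and $\lim_{n\to\infty}\alpha_n=\infty$. For $k,n\in\mathbb{N}$ put $w_k(n):=e^{-\alpha_n/k}$. The power series space of finite type is $\Lambda_0(\alpha):=\{x\in\mathbb{C}^{\mathbb{N}}\colon \lim_{n\to\infty}w_k(n)|x_n|=0 \text{ for all } k\in\mathbb{N}\}$, a Fréchet space for the topology generated by the increasing sequence of norms $p_k(x):=\sup_{n\in\mathbb{N}}w_k(n)|x_n|$, $k\in\mathbb{N}$. Put $v(\alpha):=\inf\{\alpha_{n+1}-\alpha_n\colon n\in\mathbb{N}\}$. The discrete Cesàro operator is $\mathsf{C}x:=\left(x_1,\frac{x_1+x_2}{2},\ldots,\frac{x_1+\cdots+x_n}{n},\ldots\right)$ for $x\in\mathbb{C}^{\mathbb{N}}$;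 it maps $\Lambda_0(\alpha)$ continuously into itself. For a locally convex Hausdorff space $X$, $\mathcal{L}(X)$ is the space of continuous linear operators from $X$ into itself. For $T\in\mathcal{L}(X)$: the resolvent set $\rho(T;X)$ consists of all $\lambda\in\mathbb{C}$ such that $R(\lambda,T):=(\lambda I-T)^{-1}$ exists in $\mathcal{L}(X)$; the spectrum is $\sigma(T;X):=\mathbb{C}\setminus\rho(T;X)$; the point spectrum $\sigma_{pt}(T;X)$ is the set of $\lambda\in\mathbb{C}$ such that $\lambda I-T$ is not injective; $\rho^*(T;X)$ consists of all $\lambda\in\mathbb{C}$ for which there exists $\delta>0$ such that $B(\lambda,\delta):=\{z\in\mathbb{C}\colon|z-\lambda|<\delta\}\subseteq\rho(T;X)$ and $\{R(\mu,T)\colon\mu\in B(\lambda,\delta)\}$ is equicontinuous in $\mathcal{L}(X)$; and $\sigma^*(T;X):=\mathbb{C}\setminus\rho^*(T;X)$. Moreover, $\Sigma:=\{\frac1m\colon m\in\mathbb{N}\}$ and $\Sigma_0:=\{0\}\cup\Sigma$. *)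

(* Defs.v *)
From HB Require Import structures.
From mathcomp Require Import all_boot all_order all_algebra complex.
From mathcomp Require Import all_classical all_reals all_analysis.
From mathcomp Require Import ring lra.

Set Implicit Arguments.
Unset Strict Implicit.
Unset Printing Implicit Defensive.

Import Order.TTheory GRing.Theory Num.Theory.
Import numFieldNormedType.Exports.

Local Open Scope classical_set_scope.
Local Open Scope ring_scope.
Local Open Scope complex_scope.

(* The complex numbers are R[i] for R : realType; the alias R[i]^o carries
   their usual topology and their structure of R[i]-module.  The norms of the
   library take values in R[i]; Normc.normc is the R-valued modulus. *)

Section operators.
Context (R : realType) (E : tvsType R[i]).

(* The space L(E) of continuous linear operators on E. *)
Record continuous_operator := ContinuousOperator {
  operator_fun :> {linear E -> E};
  operator_continuous : continuous operator_fun }.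

Definition is_resolvent (T : continuous_operator) (lambda : R[i])
    (S : continuous_operator) : Prop :=
  (forall x : E, S (lambda *: x - T x) = x) /\
  (forall x : E, lambda *: S x - T (S x) = x).

Definition resolvent_set (T : continuous_operator) : set R[i]^o :=
  [set lambda | exists S, is_resolvent T lambda S].

Definition spectrum (T : continuous_operator) : set R[i]^o :=
  ~` resolvent_set T.

Definition point_spectrum (T : continuous_operator) : set R[i]^o :=
  [set lambda | ~ injective (fun x : E => (lambda : R[i]) *: x - T x)].

(* Equicontinuity of a set of linear operators, by neighbourhoods of 0.  The
   equicontinuous predicate of the library refers to entourages, and the
   uniform structure of a tvsType is not required to be translation
   invariant. *)
Definition equicontinuous_operators (H : set continuous_operator) : Prop :=
  forall V : set E, nbhs (0 : E) V ->
    exists2 U : set E, nbhs (0 : E) U & forall S, H S -> S @` U `<=` V.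

Definition resolvent_set_star (T : continuous_operator) : set R[i]^o :=
  [set lambda | exists delta : R[i], [/\ 0 < delta,
     ball lambda delta `<=` resolvent_set T &
     equicontinuous_operators
       [set S | exists2 mu, ball lambda delta mu & is_resolvent T mu S]]].

Definition spectrum_star (T : continuous_operator) : set R[i]^o :=
  ~` resolvent_set_star T.

End operators.

Section nuclear.
Context (R : realType).

Definition seminorm (E : lmodType R[i]) (p : E -> R) : Prop :=
  [/\ forall x, 0 <= p x,
      forall x y, p (x + y) <= p x + p y &
      forall (a : R[i]) x, p (a *: x) = Normc.normc a * p x].

(* B, together with pi, is the local Banach space of p: the completion of
   E / ker p for the norm induced by p.  It is determined by this property up
   to an isometric isomorphism. *)
Definition local_banach_space (E : lmodType R[i]) (p : E -> R)
    (B : completeNormedModType R[i]) (pi : {linear E -> B}) : Prop :=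
  (forall x, `|pi x| = (p x)%:C) /\ dense (range pi).

(* T = \sum_n a_n (.) b_n with \sum_n |a_n| |b_n| < oo; the dual norm |a_n| is
   replaced by an upper bound c_n of it. *)
Definition nuclear_map (A B : completeNormedModType R[i])
    (T : {linear A -> B}) : Prop :=
  exists (a : nat -> {linear A -> R[i]^o}) (b : nat -> B) (c : nat -> R),
    [/\ forall n, 0 <= c n,
        forall n x, `|a n x| <= (c n)%:C * `|x|,
        cvgn (series (fun n => (c n)%:C * `|b n| : R[i]^o)) &
        forall x, series (fun n => (a n x : R[i]) *: b n) @ \oo --> T x].

(* Every continuous seminorm p is dominated by a continuous seminorm q such
   that the canonical map T from the local Banach space of q to that of p is
   nuclear. *)
Definition nuclear_space (E : tvsType R[i]) : Prop :=
  forall p : E -> R, seminorm p -> continuous p ->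
  exists q : E -> R, [/\ seminorm q, continuous q, forall x, p x <= q x &
    exists (Bq Bp : completeNormedModType R[i])
      (piq : {linear E -> Bq}) (pip : {linear E -> Bp})
      (T : {linear Bq -> Bp}),
      [/\ local_banach_space q piq, local_banach_space p pip,
          forall x, T (piq x) = pip x & nuclear_map T]].

End nuclear.

(* All sequences are indexed from 0: alpha n, x n, weight k n and pnorm k stand
   for alpha_(n+1), x_(n+1), w_(k+1)(n+1) and p_(k+1). *)

Arguments Normc.normc : simpl never.

Section power_series_space.
Context (R : realType).
Implicit Types (alpha : nat -> R) (x : nat -> R[i]^o).

Definition increasing_to_infty alpha : Prop :=
  [/\ forall n, 1 < alpha n, forall n, alpha n < alpha n.+1 &
      alpha @ \oo --> +oo].

Definition min_gap alpha : R :=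
  inf (range (fun n => alpha n.+1 - alpha n)).

Definition weight alpha (k n : nat) : R := expR (- (alpha n / k.+1%:R)).

Definition Lambda0_pred alpha : {pred nat -> R[i]^o} := fun x =>
  `[< forall k, weight alpha k n * Normc.normc (x n) @[n --> \oo] --> 0 >].

Lemma Lambda0_predP alpha x : reflect
  (forall k, weight alpha k n * Normc.normc (x n) @[n --> \oo] --> 0)
  (x \in Lambda0_pred alpha).
Proof. exact: asboolP. Qed.

Lemma weight_gt0 alpha k n : 0 < weight alpha k n.
Proof. exact: expR_gt0. Qed.

Lemma normc_ge0 (z : R[i]) : 0 <= Normc.normc z.
Proof. by case: z => a b; rewrite /Normc.normc sqrtr_ge0. Qed.

Lemma normc_eq0 (z : R[i]) : z = 0 -> Normc.normc z = 0.
Proof. by move=> ->; exact: Normc.normc0. Qed.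

Lemma Lambda0_submod_closed alpha : submod_closed (Lambda0_pred alpha).
Proof.
split.
  apply/Lambda0_predP => k.
  rewrite [X in X @ _](_ : _ = fun=> 0); first exact: cvg_cst.
  by apply/funext => n; rewrite /= normc_eq0 ?mulr0.
move=> a x y /Lambda0_predP xl /Lambda0_predP yl; apply/Lambda0_predP => k.
have H : Normc.normc a * (weight alpha k n * Normc.normc (x n))
    + weight alpha k n * Normc.normc (y n) @[n --> \oo] --> (0 : R).
  rewrite [X in _ --> X](_ : _ = Normc.normc a * 0 + 0); last first.
    by rewrite mulr0 addr0.
  by apply: cvgD; [apply: cvgM; [exact: cvg_cst|exact: xl]|exact: yl].
apply: (@squeeze_cvgr _ _ _ _ (fun=> 0) _ _ _ _ _ H); last exact: cvg_cst.
near=> n; rewrite mulr_ge0 ?normc_ge0 ?(ltW (weight_gt0 _ _ _))//=.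
rewrite mulrCA -mulrDr ler_wpM2l ?(ltW (weight_gt0 _ _ _))//.
by rewrite (le_trans (le_normcD _ _))// -Normc.normcM.
Unshelve. all: by end_near. Qed.

HB.instance Definition _ alpha := GRing.isSubmodClosed.Build _ _
  (Lambda0_pred alpha) (@Lambda0_submod_closed alpha).

Record Lambda0 alpha := MkLambda0 {
  Lambda0_val :> nat -> R[i]^o;
  _ : Lambda0_val \in Lambda0_pred alpha }.

HB.instance Definition _ alpha := [isSub for @Lambda0_val alpha].
HB.instance Definition _ alpha := [Choice of Lambda0 alpha by <:].
HB.instance Definition _ alpha := [SubChoice_isSubLmodule of Lambda0 alpha by <:].

Definition pnorm alpha (k : nat) (x : Lambda0 alpha) : R :=
  sup (range (fun n => weight alpha k n * Normc.normc (x n))).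

Lemma Lambda0P alpha (x : Lambda0 alpha) k :
  weight alpha k n * Normc.normc (x n) @[n --> \oo] --> 0.
Proof. by move/Lambda0_predP : (valP x); exact. Qed.

Lemma pnorm_has_sup alpha k (x : Lambda0 alpha) :
  has_sup (range (fun n => weight alpha k n * Normc.normc (x n))).
Proof.
split; first by exists (weight alpha k 0 * Normc.normc (x 0%N)), 0%N.
have := cvg_seq_bounded (cvgP _ (Lambda0P x k)).
move=> [M [_ HM]]; exists (M + 1) => _ [n _ <-].
by rewrite (le_trans (ler_norm _))// HM// ltrDl.
Qed.

Lemma pnorm_ub alpha k (x : Lambda0 alpha) n :
  weight alpha k n * Normc.normc (x n) <= pnorm k x.
Proof. by apply: sup_upper_bound; [exact: pnorm_has_sup|exists n]. Qed.

Lemma pnorm_le alpha k (x : Lambda0 alpha) (M : R) :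
  (forall n, weight alpha k n * Normc.normc (x n) <= M) -> pnorm k x <= M.
Proof.
move=> xM; apply: ge_sup; first by case: (pnorm_has_sup k x).
by move=> _ [n _ <-].
Qed.

Lemma pnorm_ge0 alpha k (x : Lambda0 alpha) : 0 <= pnorm k x.
Proof.
by rewrite (le_trans _ (pnorm_ub k x 0))// mulr_ge0 ?normc_ge0// ltW ?weight_gt0.
Qed.

Lemma pnormD alpha k (x y : Lambda0 alpha) :
  pnorm k (x + y) <= pnorm k x + pnorm k y.
Proof.
apply: pnorm_le => n.
apply: (le_trans _ (lerD (pnorm_ub k x n) (pnorm_ub k y n))).
by rewrite -mulrDr ler_wpM2l ?le_normcD// ltW ?weight_gt0.
Qed.

Lemma pnorm0 alpha k : pnorm k (0 : Lambda0 alpha) = 0.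
Proof.
apply/eqP; rewrite eq_le pnorm_ge0 andbT; apply: pnorm_le => n.
by rewrite /= normc_eq0 ?mulr0.
Qed.

Lemma pnormZ alpha k (a : R[i]) (x : Lambda0 alpha) :
  pnorm k (a *: x) = Normc.normc a * pnorm k x.
Proof.
have le (b : R[i]) (y : Lambda0 alpha) :
    pnorm k (b *: y) <= Normc.normc b * pnorm k y.
  apply: pnorm_le => n; rewrite (Normc.normcM b (y n : R[i])).
  by rewrite mulrCA ler_wpM2l ?pnorm_ub ?normc_ge0.
apply/eqP; rewrite eq_le le /=.
have [->|a0] := eqVneq a 0; first by rewrite normc_eq0 ?mul0r ?pnorm_ge0.
have := le a^-1 (a *: x); rewrite scalerA mulVf// scale1r Normc.normcV.
rewrite ler_pdivlMl// lt_neqAle normc_ge0 andbT eq_sym.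
by apply: contra_neq a0; exact: Normc.eq0_normc.
Qed.

Lemma pnorm_seminorm alpha k : seminorm (@pnorm alpha k).
Proof.
split; [exact: pnorm_ge0|exact: pnormD|exact: pnormZ].
Qed.

Lemma pnormN alpha k (x : Lambda0 alpha) : pnorm k (- x) = pnorm k x.
Proof. by rewrite -scaleN1r pnormZ normcN Normc.normc1 mul1r. Qed.

Lemma pnorm_eq0 alpha k (x : Lambda0 alpha) : pnorm k x = 0 -> x = 0.
Proof.
move=> x0; apply/val_inj/funext => n /=; apply: Normc.eq0_normc.
apply/eqP; rewrite eq_le normc_ge0 andbT.
by rewrite -(ler_pM2l (weight_gt0 alpha k n)) mulr0 -x0 pnorm_ub.
Qed.

(* The topology generated by the norms pnorm k: the finite intersections of
   balls {y | pnorm j (y - x) < e} form a base of neighbourhoods of x. *)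
Definition Lambda0_ball alpha (x : Lambda0 alpha) (k : nat) (e : R) :
    set (Lambda0 alpha) :=
  [set y | forall j, (j <= k)%N -> pnorm j (y - x) < e].

Definition Lambda0_nbhs alpha (x : Lambda0 alpha) : set_system (Lambda0 alpha) :=
  [set U | exists k (e : R), 0 < e /\ Lambda0_ball x k e `<=` U].

HB.instance Definition _ alpha :=
  hasNbhs.Build (Lambda0 alpha) (@Lambda0_nbhs alpha).

Lemma Lambda0_ballxx alpha (x : Lambda0 alpha) k e : 0 < e ->
  Lambda0_ball x k e x.
Proof. by move=> e0 j _; rewrite subrr pnorm0. Qed.

Lemma Lambda0_nbhs_filter alpha (x : Lambda0 alpha) : ProperFilter (nbhs x).
Proof.
apply: Build_ProperFilter_ex.
  by move=> A [k [e [e0 xA]]]; exists x; apply: xA; exact: Lambda0_ballxx.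
split.
- by exists 0%N, 1.
- move=> A B [k [e [e0 xA]]] [l [d [d0 xB]]].
  exists (maxn k l), (Num.min e d); split; first by rewrite lt_min e0.
  move=> y yb; split.
    apply: xA => j jk; have := yb j; rewrite leq_max jk => /(_ isT).
    by rewrite lt_min => /andP[].
  apply: xB => j jl; have := yb j; rewrite leq_max jl orbT => /(_ isT).
  by rewrite lt_min => /andP[].
- move=> A B AB [k [e [e0 xA]]]; exists k, e; split=> //.
  exact: subset_trans AB.
Qed.

Lemma Lambda0_nbhs_singleton alpha (x : Lambda0 alpha) (A : set (Lambda0 alpha)) :
  nbhs x A -> A x.
Proof. by move=> [k [e [e0 xA]]]; apply: xA; exact: Lambda0_ballxx. Qed.

Lemma Lambda0_ball_nbhs alpha (x y : Lambda0 alpha) k e :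
  Lambda0_ball x k e y -> nbhs y (Lambda0_ball x k e).
Proof.
move=> xy.
suff [d [d0 dH]] : exists d, 0 < d /\ forall j, (j <= k)%N ->
    pnorm j (y - x) + d <= e.
  exists k, d; split=> // z yz j jk.
  rewrite (lt_le_trans _ (dH _ jk))//.
  rewrite (_ : z - x = (y - x) + (z - y)); last by rewrite [RHS]addrC subrKA.
  by rewrite (le_lt_trans (pnormD _ _ _))// ltrD2l yz.
have : forall j, (j <= k)%N -> pnorm j (y - x) < e by exact: xy.
move: {xy} k; elim=> [|k IH] H.
  exists (e - pnorm 0 (y - x)); split; first by rewrite subr_gt0 H.
  by move=> j; rewrite leqn0 => /eqP ->; rewrite addrC subrK.
have [d [d0 dH]] := IH (fun j jk => H j (leqW jk)).
exists (Num.min d (e - pnorm k.+1 (y - x))); split.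
  by rewrite lt_min d0 subr_gt0 H.
move=> j; rewrite leq_eqVlt => /orP[/eqP ->|].
  by rewrite -lerBrDl ge_min lexx orbT.
by rewrite ltnS => jk; rewrite (le_trans _ (dH _ jk))// lerD2l ge_min lexx.
Qed.

Lemma Lambda0_nbhs_nbhs alpha (x : Lambda0 alpha) (A : set (Lambda0 alpha)) :
  nbhs x A -> nbhs x (nbhs^~ A).
Proof.
move=> [k [e [e0 xA]]]; exists k, e; split=> // y /Lambda0_ball_nbhs.
by move=> [l [d [d0 yB]]]; exists l, d; split=> //; exact: subset_trans xA.
Qed.

HB.instance Definition _ alpha := Nbhs_isNbhsTopological.Build (Lambda0 alpha)
  (@Lambda0_nbhs_filter alpha) (@Lambda0_nbhs_singleton alpha)
  (@Lambda0_nbhs_nbhs alpha).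

Lemma Lambda0_cvgP alpha (F : set_system (Lambda0 alpha)) (FF : Filter F)
    (x : Lambda0 alpha) :
  (forall k e, 0 < e -> \forall y \near F, pnorm k (y - x) < e) -> F --> x.
Proof.
move=> H A [k [e [e0 xA]]]; apply: filterS xA _.
elim: k => [|k IH].
  by apply: filterS (H 0%N _ e0) => y yx j; rewrite leqn0 => /eqP ->.
apply: filterS2 (H k.+1 _ e0) IH => y yx yb j.
by rewrite leq_eqVlt ltnS => /orP[/eqP ->|/yb].
Qed.

Lemma near_pnorm alpha (x : Lambda0 alpha) k (e : R) : 0 < e ->
  \forall y \near x, pnorm k (y - x) < e.
Proof. by move=> e0; exists k, e; split=> // y; apply. Qed.

Lemma Lambda0_add_continuous alpha :
  continuous (fun x : Lambda0 alpha * Lambda0 alpha => x.1 + x.2).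
Proof.
move=> [x y]; apply: Lambda0_cvgP => k e e0.
have e20 : 0 < e / 2 by rewrite divr_gt0.
rewrite near_map; near=> z.
have -> : z.1 + z.2 - (x + y) = (z.1 - x) + (z.2 - y) by rewrite opprD addrACA.
rewrite (le_lt_trans (pnormD _ _ _))//.
rewrite (splitr e) ltrD//.
  by near: z; apply: (cvg_fst (near_pnorm x k e20)).
by near: z; apply: (cvg_snd (near_pnorm y k e20)).
Unshelve. all: by end_near. Qed.

Lemma near_normc (a : R[i]^o) (e : R) : 0 < e ->
  \forall b \near a, Normc.normc (b - a : R[i]) < e.
Proof.
move=> e0; have e0' : 0 < e%:C by rewrite ltcR.
apply/nbhs_ballP; exists e%:C => //= b; rewrite -ball_normE /= distrC.
by rewrite -ltcR.
Qed.

Lemma Lambda0_scale_continuous alpha :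
  continuous (fun z : R[i]^o * Lambda0 alpha => (z.1 : R[i]) *: z.2).
Proof.
move=> [a x]; apply: Lambda0_cvgP => k e e0.
have p1 : 0 < 1 + pnorm k x by rewrite ltr_pwDl ?pnorm_ge0.
have a1 : 0 < 1 + Normc.normc a by rewrite ltr_pwDl ?normc_ge0.
have e1 : 0 < e / 2 / (1 + pnorm k x) by rewrite !divr_gt0.
have e2 : 0 < e / 2 / (1 + Normc.normc a) by rewrite !divr_gt0.
rewrite near_map; near=> z.
have -> : (z.1 : R[i]) *: z.2 - (a : R[i]) *: x =
    (z.1 : R[i]) *: (z.2 - x) + (z.1 - a : R[i]) *: x.
  by rewrite scalerBr scalerBl addrA subrK.
rewrite (le_lt_trans (pnormD _ _ _))// (splitr e) ltrD//.
- rewrite pnormZ.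
  have z1a : Normc.normc (z.1 : R[i]) <= 1 + Normc.normc a.
    rewrite -[z.1 : R[i]](subrK a) (le_trans (le_normcD _ _))// lerD2r ltW//.
    by near: z; exact: (cvg_fst (near_normc a ltr01)).
  apply: (le_lt_trans (ler_wpM2r (pnorm_ge0 _ _) z1a)).
  rewrite mulrC -ltr_pdivlMr//.
  by near: z; exact: (cvg_snd (near_pnorm x k e2)).
- rewrite pnormZ.
  apply: (@le_lt_trans _ _ (Normc.normc (z.1 - a : R[i]) * (1 + pnorm k x))).
    by rewrite ler_wpM2l ?normc_ge0// lerDr.
  rewrite -ltr_pdivlMr//.
  by near: z; exact: (cvg_fst (near_normc a e1)).
Unshelve. all: by end_near. Qed.

Lemma Lambda0_locally_convex alpha :
  exists2 B : set_system (Lambda0 alpha),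
    (forall b, b \in B -> convex_set b) & basis B.
Proof.
exists [set U | exists (x : Lambda0 alpha) k e, U = Lambda0_ball x k e].
  move=> U; rewrite inE => -[x [k [e ->]]] y z l; rewrite !inE => yb zb j jk.
  have [l0 l1] : 0 <= l%:num /\ 0 <= 1 - l%:num by rewrite subr_ge0; split.
  set t := l%:num in l0 l1 *.
  rewrite [X in X - x](_ : _ = t *: y + (1 - t) *: z)//.
  have -> : t *: y + (1 - t) *: z - x = t *: (y - x) + (1 - t) *: (z - x).
    by rewrite !scalerBr addrACA -opprD -scalerDl subrKC scale1r.
  rewrite (le_lt_trans (pnormD _ _ _))// !pnormZ.
  have nt (c : R[i]) : 0 <= c -> (Normc.normc c)%:C = c.
    by move=> c0; rewrite -[RHS]ger0_norm.
  have n1 : Normc.normc t + Normc.normc (1 - t) = 1.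
    by apply: (@complexI R); rewrite rmorphD/= !nt// subrKC.
  have : 0 < Normc.normc t \/ 0 < Normc.normc (1 - t).
    by apply/orP; rewrite -[_ || _]negbK negb_or -!leNgt; apply/negP => /andP[]; lra.
  have := normc_ge0 t; have := normc_ge0 (1 - t).
  have := yb _ jk; have := zb _ jk.
  set u := pnorm j (y - x); set v := pnorm j (z - x).
  move: n1; set a := Normc.normc t; set b := Normc.normc (1 - t).
  by move=> n1 vz uz b0 a0 [ab|ab]; nra.
split.
  move=> _ [x [k [e ->]]]; rewrite openE => y; exact: Lambda0_ball_nbhs.
move=> x A [k [e [e0 xA]]]; exists (Lambda0_ball x k e) => //.
by split; [exists x, k, e|exact: Lambda0_ballxx].
Qed.

(* This factory only derives the uniform structure of the topological vector
   space, whence the three instances that follow it. *)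
HB.instance Definition _ alpha := PreTopologicalLmod_isTvs.Build R[i]
  (Lambda0 alpha) (@Lambda0_add_continuous alpha)
  (@Lambda0_scale_continuous alpha) (@Lambda0_locally_convex alpha).
HB.instance Definition _ alpha :=
  PreTopologicalNmodule_isTopologicalNmodule.Build (Lambda0 alpha)
    (@Lambda0_add_continuous alpha).
HB.instance Definition _ alpha :=
  TopologicalNmodule_isTopologicalLmodule.Build R[i] (Lambda0 alpha)
    (@Lambda0_scale_continuous alpha).
HB.instance Definition _ alpha :=
  Uniform_isTvs.Build R[i] (Lambda0 alpha) (@Lambda0_locally_convex alpha).

Lemma Lambda0_hausdorff alpha : hausdorff_space (Lambda0 alpha).
Proof.
move=> x y xy; apply/eqP; rewrite -subr_eq0; apply/eqP.
apply: (@pnorm_eq0 _ 0); apply/eqP; rewrite eq_le pnorm_ge0 andbT.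
apply/ler_addgt0Pl => e e0; rewrite addr0.
have e20 : 0 < e / 2 by rewrite divr_gt0.
have [z [zx zy]] := xy _ _ (near_pnorm x 0 e20) (near_pnorm y 0 e20).
rewrite (_ : x - y = (z - y) - (z - x)); last by rewrite opprB [RHS]addrC subrKA.
by rewrite (le_trans (pnormD _ _ _))// pnormN (splitr e) lerD// ltW.
Qed.

Definition cesaro_seq x : nat -> R[i]^o :=
  fun n => (n.+1%:R : R[i])^-1 * \sum_(i < n.+1) x i.

Lemma weight_nonincreasing alpha k m n : increasing_to_infty alpha ->
  (m <= n)%N -> weight alpha k n <= weight alpha k m.
Proof.
move=> [_ + _] mn => /(fun H i => ltW (H i))/nondecreasing_seqP amn.
by rewrite ler_expR lerN2 ler_pM2r ?invr_gt0// amn.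
Qed.

Lemma normc_cesaro_seq alpha k x n : increasing_to_infty alpha ->
  weight alpha k n * Normc.normc (cesaro_seq x n) <=
  arithmetic_mean (fun i => weight alpha k i * Normc.normc (x i)) n.
Proof.
move=> halpha; rewrite /cesaro_seq /arithmetic_mean/= Normc.normcM mulrCA.
have -> : Normc.normc ((n.+1%:R : R[i])^-1) = n.+1%:R^-1.
  apply: (@complexI R); rewrite -[LHS]/(`|(n.+1%:R : R[i])^-1|) normfV normr_nat.
  by rewrite fmorphV rmorph_nat.
rewrite ler_wpM2l ?invr_ge0// seriesEord/=.
have : Normc.normc (\sum_(i < n.+1) x i : R[i]) <=
    \sum_(i < n.+1) Normc.normc (x i).
  elim/big_ind2 : _ => //; first by rewrite normc_eq0.
  by move=> u v s t uv st; rewrite (le_trans (le_normcD _ _))// lerD.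
move=> /(ler_wpM2l (ltW (weight_gt0 alpha k n)))/le_trans; apply.
rewrite mulr_sumr ler_sum// => i _; rewrite ler_wpM2r ?normc_ge0//.
by rewrite weight_nonincreasing// -ltnS.
Qed.

Lemma cesaro_seq_Lambda0 alpha (halpha : increasing_to_infty alpha)
    (x : Lambda0 alpha) : cesaro_seq x \in Lambda0_pred alpha.
Proof.
apply/Lambda0_predP => k.
apply: (squeeze_cvgr _ _ (cesaro (Lambda0P x k))); last exact: cvg_cst.
near=> n; rewrite normc_cesaro_seq// andbT.
by rewrite mulr_ge0 ?normc_ge0// ltW ?weight_gt0.
Unshelve. all: by end_near. Qed.

Section cesaro_operator.
Context (alpha : nat -> R) (halpha : increasing_to_infty alpha).

Definition cesaro_fun (x : Lambda0 alpha) : Lambda0 alpha :=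
  MkLambda0 (cesaro_seq_Lambda0 halpha x).

Lemma cesaro_fun_is_linear : linear cesaro_fun.
Proof.
move=> a x y; apply/val_inj/funext => n /=.
rewrite -[RHS]/(a * cesaro_seq x n + cesaro_seq y n : R[i]) /cesaro_seq.
by rewrite big_split/= -mulr_sumr mulrDr mulrCA.
Qed.

HB.instance Definition _ := GRing.isLinear.Build R[i] (Lambda0 alpha)
  (Lambda0 alpha) _ cesaro_fun cesaro_fun_is_linear.

Lemma pnorm_cesaro k (x : Lambda0 alpha) : pnorm k (cesaro_fun x) <= pnorm k x.
Proof.
apply: pnorm_le => n; rewrite (le_trans (normc_cesaro_seq _ _ _ _))//.
rewrite /arithmetic_mean/= seriesEord/= ler_pdivrMl// mulr_natl.
rewrite -[in leRHS](card_ord n.+1) -sumr_const ler_sum// => i _.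
exact: pnorm_ub.
Qed.

Lemma cesaro_fun_continuous : continuous cesaro_fun.
Proof.
move=> x; have Fx : Filter (nbhs x) by exact: nbhs_filter.
apply: (@Lambda0_cvgP _ (cesaro_fun @ x) _ (cesaro_fun x)) => k e e0.
apply: filterS (near_pnorm x k e0) => y; apply: le_lt_trans.
by rewrite -linearB; exact: pnorm_cesaro.
Qed.

Definition cesaro_operator : continuous_operator (Lambda0 alpha) :=
  ContinuousOperator cesaro_fun_continuous.

End cesaro_operator.

Definition Sigma : set R[i]^o := [set (m.+1%:R : R[i])^-1 | m in [set: nat]].

Definition Sigma0 : set R[i]^o := [set (0 : R[i])] `|` Sigma.

End power_series_space.

Arguments Sigma R : clear implicits.
Arguments Sigma0 R : clear implicits.

(* Main.v *)
From HB Require Import structures.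
Require Import Defs.
From mathcomp Require Import all_boot all_order all_algebra complex.
From mathcomp Require Import all_classical all_reals all_analysis.
From mathcomp Require Import ring lra.
Import Order.TTheory GRing.Theory Num.Theory.
Import numFieldNormedType.Exports.
Local Open Scope classical_set_scope.
Local Open Scope ring_scope.

(** Nuclearity enters through a single consequence: every power of n times
    every weight w_k(n) is bounded in n ([nuclear_weights]).  This comes from a
    trace argument.  By nuclearity the canonical map between the local Banach
    spaces of two of the norms, which is diagonal with entries w_k(n) / w_l(n),
    is a limit of finite rank operators of bounded nuclear norm
    ([nuclear_finite_rank]); the trace being at most the nuclear norm, the sum
    of the w_k(n) / w_l(n) is finite ([nuclear_weight_summable]).  As weights
    decrease in n and powers of weights are weights, the boundedness follows.

    So polynomial losses cost nothing in the space.  On the one hand, the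
    eigenvector of the averaging map for 1 / m, a sequence of binomial
    coefficients, belongs to the space, and Sigma consists of eigenvalues
    ([Sigma_sub_point_spectrum]).  On the other hand, for lam outside Sigma the
    equation lam x - C x = y is solved by a recursion, and x is bounded by y
    with a polynomial loss: for lam = 0 because the inverse is explicit
    ([cesaro_inverse_dominated]), and otherwise because lam has a positive
    distance to Sigma and the partial sums of x satisfy a Gronwall type
    recursion ([cesaro_equation_dominated]).  Hence lam is in the resolvent set
    ([compl_Sigma_resolvent]).  This proves the first part.

    The estimate depends on lam only through its distance to Sigma, which is
    bounded below on a small disc around any point outside Sigma0.  There the
    resolvents are therefore equicontinuous, and the set sigma^* is contained
    in Sigma0 ([compl_Sigma0_resolvent_star]).  Conversely sigma^* contains the
    closure of the spectrum, which is Sigma0. *)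

Set Implicit Arguments.
Unset Strict Implicit.
Unset Printing Implicit Defensive.
Local Open Scope complex_scope.

(** * Weights and membership in the power series space *)

Section weights.
Context (R : realType) (alpha : nat -> R) (halpha : increasing_to_infty alpha).

Let alpha_gt0 n : 0 < alpha n.
Proof. by case: halpha => h _ _; exact: lt_trans (h n). Qed.

(** With indices shifted by one this reads w_((s+1)(k+1))^(s+1) = w_(k+1): a
    weight is a power of a later weight.  This is how a bound for all the
    weights improves itself: one factor pays for a loss, the other remains. *)
Lemma weight_exp k s n : weight alpha (s.+1 * k.+1).-1 n ^+ s.+1 = weight alpha k n.
Proof.
rewrite /weight -expRM_natl prednK ?muln_gt0// natrM mulrN mulrCA invfM.
by rewrite (mulrA s.+1%:R) mulfV ?pnatr_eq0// mul1r.
Qed.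

Lemma weight_le1 k n : weight alpha k n <= 1.
Proof. by rewrite -expR0 ler_expR oppr_le0 divr_ge0// ltW. Qed.

Lemma weight_ndecr k l n : (k <= l)%N -> weight alpha k n <= weight alpha l n.
Proof.
move=> kl; rewrite ler_expR lerN2 ler_wpM2l ?(ltW (alpha_gt0 n))//.
by rewrite lef_pV2 ?posrE ?ltr0n// ler_nat.
Qed.

Lemma weight_cvg0 k : weight alpha k n @[n --> \oo] --> 0.
Proof.
case: halpha => _ _ aoo.
apply/cvgrPdist_lt => e e0; near=> n; rewrite sub0r normrN gtr0_norm ?weight_gt0//.
rewrite -[e]lnK ?posrE// ltr_expR ltrNl ltr_pdivlMr ?ltr0n//.
by near: n; move/cvgryPgt: aoo; exact.
Unshelve. all: by end_near. Qed.

Lemma pnorm_ndecr k l (x : Lambda0 alpha) : (k <= l)%N -> pnorm k x <= pnorm l x.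
Proof.
move=> kl; apply: pnorm_le => n; apply: le_trans (pnorm_ub l x n).
by rewrite ler_wpM2r ?normc_ge0// weight_ndecr.
Qed.

(** Boundedness for every weight already gives convergence to 0 for every
    weight, because w_k is the square of a later weight, which tends to 0. *)
Lemma Lambda0_of_bounded (x : nat -> R[i]^o) :
  (forall k, exists K, forall n, weight alpha k n * Normc.normc (x n) <= K) ->
  x \in Lambda0_pred alpha.
Proof.
move=> xb; apply/Lambda0_predP => k.
have [K xK] := xb (2 * k.+1).-1.
have lim0 : weight alpha (2 * k.+1).-1 n * K @[n --> \oo] --> (0 : R).
  by rewrite -[X in _ --> X](mul0r K); apply: cvgMl; exact: weight_cvg0.
apply: (squeeze_cvgr _ _ lim0); last exact: cvg_cst.
near=> n; rewrite mulr_ge0 ?normc_ge0 ?(ltW (weight_gt0 _ _ _))//=.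
by rewrite -(weight_exp k 1) expr2 -mulrA ler_wpM2l// ltW ?weight_gt0.
Unshelve. all: by end_near. Qed.

Lemma Lambda0_valB (x y : Lambda0 alpha) n : (x - y) n = x n - y n.
Proof. by []. Qed.

Lemma Lambda0_valZ (a : R[i]) (x : Lambda0 alpha) n : (a *: x) n = a * x n.
Proof. by []. Qed.

Lemma Lambda0_val_sum I (r : seq I) P (F : I -> Lambda0 alpha) n :
  (\sum_(i <- r | P i) F i) n = \sum_(i <- r | P i) (F i n : R[i]).
Proof. by elim/big_rec2 : _ => // i y1 y2 _ <-. Qed.

Lemma Lambda0_eq (x y : Lambda0 alpha) : (forall n, x n = y n) -> x = y.
Proof. by move=> xy; apply/val_inj/funext. Qed.

Lemma unit_seq_Lambda0 m :
  (fun n : nat => (n == m)%:R : R[i]^o) \in Lambda0_pred alpha.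
Proof.
apply: Lambda0_of_bounded => k; exists 1 => n.
case: eqP => _; last by rewrite normc_eq0// mulr0.
by rewrite (Normc.normc1 R) mulr1 weight_le1.
Qed.

Definition unit_seq m : Lambda0 alpha := MkLambda0 (unit_seq_Lambda0 m).

Lemma continuous_pnorm k : continuous (@pnorm R alpha k).
Proof.
move=> x; have Fx : Filter (nbhs x) by exact: nbhs_filter.
apply/cvgrPdist_lt => e e0; apply: filterS (near_pnorm x k e0) => y /le_lt_trans; apply.
rewrite ler_norml; apply/andP; split.
  rewrite lerNl opprB lerBlDr; apply: le_trans (pnormD _ _ _).
  by rewrite subrK.
rewrite lerBlDr -[pnorm k (y - x)]pnormN opprB; apply: le_trans (pnormD _ _ _).
by rewrite subrK.
Qed.

End weights.

(** * Finite rank approximation from nuclearity *)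

Section nuclear_approximation.
Context (R : realType).

(** A nuclear operator is approximated by finite rank operators whose nuclear
    norms stay bounded.  Here this is stated on E itself, for the canonical
    map between two local Banach spaces: the vectors b_m of the nuclear
    representation lie in a completion of E, and are replaced by nearby images
    of elements y_m of E.  The bound L does not depend on N, x and e. *)
Lemma nuclear_finite_rank (E : tvsType R[i]) (p : E -> R) :
  nuclear_space E -> seminorm p -> continuous p ->
  exists (q : E -> R) (L : R), [/\ seminorm q, continuous q &
    forall N (x : nat -> E) (e : R), 0 < e ->
    exists M (g : nat -> {linear E -> R[i]^o}) (c : nat -> R) (y : nat -> E),
    [/\ forall m, 0 <= c m,
        forall m z, Normc.normc (g m z) <= c m * q z,
        forall n, (n < N)%N ->
          p (x n - \sum_(m < M) (g m (x n) : R[i]) *: y m) <= e &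
        \sum_(m < M) c m * p (y m) <= L]].
Proof.
move=> nE p_semi p_cont.
have [q [q_semi q_cont _ [Bq [Bp [piq [pip [T [[piqE _] [pipE pipD] TE]]]]]]]] :=
  nE p p_semi p_cont.
move=> [a [b [c [c0 ac cb_cvg Tab]]]].
have q0 z : 0 <= q z by case: q_semi.
have [K K0 cbK] : exists2 K : R, 0 <= K &
    forall M, \sum_(m < M) (c m)%:C * `|b m| <= K%:C.
  have [K [Kreal HK]] := cvg_seq_bounded cb_cvg.
  have cbK M : \sum_(m < M) (c m)%:C * `|b m| <= K + 1.
    have K1 : K < K + 1 by rewrite ltrDl.
    have := HK _ K1 M I.
    rewrite /series/= big_mkord => /(le_trans _); apply.
    apply/real_ler_norm/ger0_real/sumr_ge0 => m _.
    by rewrite mulr_ge0// lecR.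
  have K1 : 0 <= K + 1 by apply: le_trans (cbK 0%N); rewrite big_ord0.
  exists (complex.Re (K + 1)); first by move: K1; rewrite lecE => /andP[].
  by move=> M; rewrite RRe_real ?ger0_real.
exists q, (K + 1); split=> // N x e e0.
have e20 : 0 < (e / 2)%:C by rewrite ltcR divr_gt0.
have [M HM] : exists M, forall n : 'I_N,
    `|pip (x n) - \sum_(m < M) (a m (piq (x n)) : R[i]) *: b m| < (e / 2)%:C.
  have : \forall M \near \oo, forall n : 'I_N,
      `|pip (x n) - \sum_(m < M) (a m (piq (x n)) : R[i]) *: b m| < (e / 2)%:C.
    apply: filter_forall => n; have /cvgrPdist_lt/(_ _ e20) := Tab (piq (x n)).
    apply: filterS => M; by rewrite TE /series/= big_mkord.
  by case=> M _ HM; exists M; exact: HM (leqnn M).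
(* G dominates both the sum of the |a_m (x_n)|, for each n < N, and the sum of
   the c_m; these are the factors by which the error in y_m is multiplied. *)
pose G := \sum_(m < M) c m * (1 + \sum_(n < N) q (x n)).
have G0 : 0 <= G.
  by apply: sumr_ge0 => m _; rewrite mulr_ge0// addr_ge0// sumr_ge0.
pose eps := Num.min (e / 2) 1 / (1 + G).
have eps0 : 0 < eps by rewrite divr_gt0 ?ltr_pwDl// lt_min divr_gt0/=.
have epsG : G * eps <= Num.min (e / 2) 1.
  have m0 : 0 <= Num.min (e / 2) 1 by rewrite le_min divr_ge0 ?(ltW e0)/=.
  rewrite mulrC -mulrA ler_piMr//.
  by rewrite ler_pdivrMl ?mulr1 ?ltr_pwDl// lerDr.
have /choice[y yb] : forall m, exists y, `|b m - pip y| < eps%:C.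
  move=> m; have eC : 0 < eps%:C by rewrite ltcR.
  have bb : ball (b m) eps%:C !=set0 by exists (b m); exact: ballxx.
  have [z []] := pipD _ bb (ball_open _ _).
  by rewrite -ball_normE => /= by_ [y _ yE]; exists y; rewrite yE.
exists M, (fun m => a m \o piq), c, y; split=> //.
- by move=> m z; have := ac m (piq z); rewrite piqE -rmorphM -lecR.
- move=> n nN; rewrite -lecR -pipE linearB linear_sum/=.
  (* Split the error into the tail of the series and the cost of replacing
     b_m by pip (y m). *)
  rewrite (eq_bigr (fun m : 'I_M => (a m (piq (x n)) : R[i]) *: b m -
      (a m (piq (x n)) : R[i]) *: (b m - pip (y m)))); last first.
    by move=> m _; rewrite linearZ/= scalerBr opprB addrC subrK.
  rewrite sumrB opprB addrC addrAC -addrA addrC.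
  rewrite (splitr e) rmorphD (le_trans (ler_normD _ _))// lerD//.
    by apply: ltW; exact: (HM (Ordinal nN)).
  apply: (@le_trans _ _ (G * eps)%:C); last first.
    by rewrite lecR (le_trans epsG)// ge_min lexx.
  rewrite (le_trans (ler_norm_sum _ _ _))// rmorphM /G rmorph_sum mulr_suml.
  apply: ler_sum => m _; rewrite normrZ ler_pM// ?(ltW (yb _))//.
  rewrite (le_trans (ac _ _))// piqE -rmorphM lecR ler_wpM2l//.
  rewrite (bigD1 (Ordinal nN))//= addrCA lerDl addr_ge0// sumr_ge0//.
- rewrite -lecR rmorph_sum rmorphD/=.
  apply: (@le_trans _ _ (\sum_(m < M) ((c m)%:C * `|b m| + (c m)%:C * eps%:C))).
    apply: ler_sum => m _; rewrite rmorphM/= -mulrDr ler_wpM2l ?lecR//.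
    rewrite -pipE -[pip _](subKr (b m)) (le_trans (ler_normB _ _))//.
    by rewrite lerD2l ltW.
  rewrite big_split/=; apply: lerD; first exact: cbK.
  rewrite -mulr_suml.
  apply: (@le_trans _ _ (G * eps)%:C); last first.
    by rewrite lecR (le_trans epsG)// ge_min lexx orbT.
  rewrite [leRHS]rmorphM /G rmorph_sum ler_wpM2r ?lecR ?(ltW eps0)//.
  apply: ler_sum => m _; rewrite lecR ler_peMr// lerDl sumr_ge0//.
Qed.

End nuclear_approximation.

(** * Rapid decrease of the weights *)

Section grothendieck_pietsch.
Context (R : realType) (alpha : nat -> R) (halpha : increasing_to_infty alpha).

Lemma normc_real (x : R) : 0 <= x -> Normc.normc x%:C = x.
Proof. by move=> x0; apply: (@complexI R); rewrite -[RHS]ger0_norm ?lecR. Qed.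

Lemma normc_sum I (r : seq I) P (F : I -> R[i]) :
  Normc.normc (\sum_(i <- r | P i) F i) <= \sum_(i <- r | P i) Normc.normc (F i).
Proof.
elim/big_ind2 : _ => //; first by rewrite normc_eq0.
by move=> u v s t uv st; rewrite (le_trans (le_normcD _ _))// lerD.
Qed.

Lemma sum_indicator (F : nat -> R[i]) (N i : nat) :
  \sum_(n < N) F n * (i == n)%:R = if (i < N)%N then F i else 0.
Proof.
case: ltnP => iN.
  rewrite (eq_bigr (fun n => if n == Ordinal iN then F i else 0)).
    by rewrite -big_mkcond big_pred1_eq.
  move=> n _; have [->|ni] := eqVneq n (Ordinal iN); first by rewrite eqxx mulr1.
  rewrite (_ : (i == n) = false) ?mulr0//.
  by apply: contraNF ni => /eqP inE; apply/eqP/val_inj.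
rewrite big1// => n _; rewrite (_ : (i == n) = false) ?mulr0//.
by apply/eqP => inE; move: (ltn_ord n); rewrite -inE ltnNge iN.
Qed.

(** The norms pnorm l increase with l, so a single one of them suffices. *)
Lemma continuous_seminorm_pnorm (q : Lambda0 alpha -> R) :
  seminorm q -> continuous q ->
  exists l (C : R), 0 <= C /\ forall z, q z <= C * pnorm l z.
Proof.
move=> [q0 qD qZ] q_cont.
have q00 : q 0 = 0 by rewrite -(scale0r 0) qZ normc_eq0// mul0r.
have q1 : \forall z \near (0 : Lambda0 alpha), q z < 1.
  have F0 : Filter (nbhs (0 : Lambda0 alpha)) by exact: nbhs_filter.
  have /cvgrPdist_lt/(_ _ ltr01) := q_cont 0; apply: filterS => z.
  by rewrite q00 sub0r normrN ger0_norm.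
have [l [d [d0 dq]]] := q1.
exists l, (2 / d); split=> [|z]; first by rewrite divr_ge0 ?ltW.
have [z0|z_neq0] := eqVneq (pnorm l z) 0.
  by rewrite z0 (pnorm_eq0 z0) q00 mulr0.
set t := pnorm l z in z_neq0 *.
have t0 : 0 < t by rewrite lt_neqAle eq_sym z_neq0 pnorm_ge0.
have a0 : 0 < d / (2 * t) by rewrite divr_gt0// mulr_gt0.
have : q ((d / (2 * t))%:C *: z) < 1.
  apply: dq => j jl; rewrite subr0 pnormZ normc_real ?(ltW a0)//.
  rewrite (le_lt_trans (ler_wpM2l (ltW a0) (pnorm_ndecr halpha z jl)))//.
  rewrite -/t [X in X < _](_ : _ = d / 2); first by lra.
  by field; rewrite gt_eqF.
rewrite qZ normc_real ?(ltW a0)// => /ltW.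
rewrite mulrC -ler_pdivlMr// => /le_trans; apply.
by rewrite div1r invf_div mulrAC.
Qed.

(** The necessity half of the Grothendieck-Pietsch criterion.  Put r n =
    w_k(n) / w_l(n).  On the vectors u_n / w_l(n), with u_n the n-th unit
    sequence, the canonical map from the norm pnorm l to the norm pnorm k is
    diagonal with entries r n, and the sum of the r n is a trace.  For a finite
    rank operator with terms g_m and y_m, exchanging the two sums gives its
    trace over n < N as the sum of the g_m (z_m), where z_m is the sequence
    r * y_m cut off at N; and pnorm l (z_m) <= pnorm k (y_m).  Hence the trace
    is at most the nuclear norm, whatever N is. *)
Lemma nuclear_weight_summable k : nuclear_space (Lambda0 alpha) ->
  exists l (L : R), forall N, \sum_(n < N) weight alpha k n / weight alpha l n <= L.
Proof.
move=> nE.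
have [q [L [q_semi q_cont HL]]] := nuclear_finite_rank nE
  (@pnorm_seminorm R alpha k) (@continuous_pnorm R alpha k).
have [l [C [C0 qC]]] := continuous_seminorm_pnorm q_semi q_cont.
exists l, (1 + C * L) => N.
pose w := weight alpha k; pose v := weight alpha l.
have w0 n : 0 < w n by exact: weight_gt0.
have v0 n : 0 < v n by exact: weight_gt0.
pose V := \sum_(n < N) (v n)^-1.
have V0 : 0 <= V by apply: sumr_ge0 => n _; rewrite invr_ge0 ltW.
(* The errors at the coordinates n < N, divided by w_l(n), then add up to at
   most 1. *)
have e0 : 0 < (1 + V)^-1 by rewrite invr_gt0 ltr_pwDl.
pose u := unit_seq halpha.
have [M [g [c [y [c0 gc approx cy]]]]] := HL N u _ e0.
pose t n : R[i] := \sum_(m < M) (g m (u n) : R[i]) * y m n.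
have t1 n : (n < N)%N -> w n * Normc.normc (1 - t n) <= (1 + V)^-1.
  move=> nN; apply: le_trans (approx n nN).
  rewrite [leLHS](_ : _ = w n *
    Normc.normc ((u n - \sum_(m < M) (g m (u n) : R[i]) *: y m) n)).
    exact: pnorm_ub.
  by rewrite Lambda0_valB Lambda0_val_sum /= eqxx.
pose r n := w n / v n.
have r0 n : 0 <= r n by rewrite divr_ge0 ?ltW.
pose z m : Lambda0 alpha := \sum_(n < N) ((r n)%:C * (y m n : R[i])) *: u n.
have zE m i : z m i = if (i < N)%N then (r i)%:C * (y m i : R[i]) else 0.
  rewrite Lambda0_val_sum; exact: (sum_indicator (fun n => (r n)%:C * y m n)).
have z_y m : pnorm l (z m) <= pnorm k (y m).
  apply: pnorm_le => i; rewrite zE; case: ifPn => iN; last first.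
    by rewrite normc_eq0// mulr0 pnorm_ge0.
  rewrite Normc.normcM normc_real// mulrA mulrCA mulfV ?gt_eqF// mulr1.
  exact: pnorm_ub.
have trace : \sum_(n < N) (r n)%:C * t n = \sum_(m < M) (g m (z m) : R[i]).
  under eq_bigr do rewrite mulr_sumr.
  rewrite exchange_big/=; apply: eq_bigr => m _.
  rewrite linear_sum; apply: eq_bigr => n _.
  by rewrite linearZ/= [RHS]mulrAC -mulrA.
have -> : \sum_(n < N) weight alpha k n / weight alpha l n =
    Normc.normc (\sum_(n < N) ((r n)%:C * (1 - t n) + (r n)%:C * t n)).
  rewrite (eq_bigr (fun n : 'I_N => (r n)%:C)); last first.
    by move=> n _; rewrite -mulrDr subrK mulr1.
  by rewrite -rmorph_sum normc_real// sumr_ge0.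
rewrite big_split/= trace (le_trans (le_normcD _ _))// lerD//.
  rewrite (le_trans (normc_sum _ _ _))//.
  apply: (@le_trans _ _ (\sum_(n < N) (v n)^-1 * (1 + V)^-1)).
    apply: ler_sum => n _; rewrite Normc.normcM normc_real//.
    by rewrite /r mulrAC mulrC ler_wpM2l ?invr_ge0 ?(ltW (v0 _))// t1.
  by rewrite -mulr_suml ler_pdivrMr ?ltr_pwDl// mul1r lerDr.
rewrite (le_trans (normc_sum _ _ _))//.
apply: le_trans (ler_wpM2l C0 cy); rewrite mulr_sumr.
apply: ler_sum => m _; rewrite (le_trans (gc _ _))// mulrCA ler_wpM2l//.
by rewrite (le_trans (qC _))// ler_wpM2l.
Qed.

(** Equivalently, log n = o(alpha_n). *)
Definition weights_rapidly_decreasing := forall B k, exists2 K : R, 0 <= K &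
  forall n, n.+1%:R ^+ B * weight alpha k n <= K.

(** The weights decrease, so n w_k(n) is at most the n-th partial sum of w_k,
    and this is bounded because w_k <= w_k / w_l.  Powers of n are absorbed by
    raising the bound for a later weight to a power. *)
Lemma nuclear_weights : nuclear_space (Lambda0 alpha) ->
  weights_rapidly_decreasing.
Proof.
move=> nE [|B] k.
  by exists 1 => // n; rewrite expr0 mul1r weight_le1.
have [l [L HL]] := nuclear_weight_summable (B.+1 * k.+1).-1 nE.
have L0 : 0 <= L by rewrite (le_trans _ (HL 0%N))// big_ord0.
exists (L ^+ B.+1) => [|n]; first exact: exprn_ge0.
rewrite -(weight_exp alpha k B) -exprMn lerXn2r ?nnegrE//.
  by rewrite mulr_ge0// ltW ?weight_gt0.
apply: le_trans (HL n.+1); rewrite mulr_natl -[in leLHS](card_ord n.+1) -sumr_const.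
apply: ler_sum => i _.
apply: (le_trans (weight_nonincreasing _ halpha (_ : (i <= n)%N))).
  by rewrite -ltnS.
by rewrite ler_pdivlMr ?weight_gt0// ler_piMr ?weight_le1 ?ltW ?weight_gt0.
Qed.

End grothendieck_pietsch.

(** * Estimates for the resolvent equation on sequences *)

Section estimates.
Context (R : realType).
Implicit Types (x y : nat -> R[i]^o) (lam : R[i]).

(** The relation in which solutions of the resolvent equation stand to the data:
    x n depends on y 0, ..., y n only, with a loss that is polynomial in n. *)
Definition polynomially_dominated (K : R) (B : nat) x y :=
  forall n M, (forall i, (i <= n)%N -> Normc.normc (y i) <= M) ->
    Normc.normc (x n) <= K * n.+1%:R ^+ B * M.

Definition cesaro_equation lam x y :=
  forall n, lam * x n - cesaro_seq x n = y n.

Lemma normc_natV n : Normc.normc (n.+1%:R^-1 : R[i]) = n.+1%:R^-1.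
Proof. by rewrite -[RHS]normc_real ?invr_ge0// fmorphV rmorph_nat. Qed.

(** The n-th equation, solved for x n in terms of the partial sum of the
    previous entries. *)
Lemma cesaro_equationP lam x y : cesaro_equation lam x y <->
  forall n, (lam - n.+1%:R^-1) * x n = y n + n.+1%:R^-1 * \sum_(i < n) x i.
Proof.
have E n : lam * x n - cesaro_seq x n =
    (lam - n.+1%:R^-1) * x n - n.+1%:R^-1 * \sum_(i < n) x i.
  by rewrite /cesaro_seq big_ord_recr/=; ring.
split=> xy n.
  by apply/eqP; rewrite -subr_eq -E xy.
by rewrite E xy addrK.
Qed.

Lemma cesaro_equation_solvable lam y : (forall n, lam - n.+1%:R^-1 != 0) ->
  exists x, cesaro_equation lam x y.
Proof.
move=> lam0.
pose next n (s : R[i]) : R[i] := (y n + n.+1%:R^-1 * s) / (lam - n.+1%:R^-1).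
(* s n is the partial sum of the x i with i < n. *)
pose s := fix s n : R[i] := if n is m.+1 then s m + next m (s m) else 0.
pose x n : R[i]^o := next n (s n).
have xs n : s n = \sum_(i < n) x i.
  by elim: n => [|n IH]; rewrite ?big_ord0// big_ord_recr/= -IH.
exists x; apply/cesaro_equationP => n; rewrite -xs /x /next.
by rewrite mulrC divfK.
Qed.

Lemma bernoulli_le (t : R) n : 0 <= t -> 1 + n%:R * t <= (1 + t) ^+ n.
Proof.
move=> t0; elim: n => [|n IH]; first by rewrite mul0r addr0 expr0.
rewrite exprS; apply: (@le_trans _ _ ((1 + t) * (1 + n%:R * t))).
  rewrite -natr1; have n0 : 0 <= n%:R :> R by [].
  by move: (n%:R : R) n0 => a a0; nra.
by rewrite ler_wpM2l// addr_ge0.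
Qed.

(** If lam stays at distance at least 1 / A from all the 1 / n, the partial
    sums S n of a solution satisfy
    |S (n + 1)| <= (1 + A / (n + 1)) |S n| + A |y n|,
    and the product of the factors 1 + A / (n + 1) grows at most like n^A by
    Bernoulli's inequality.  The bound involves lam only through A, which makes
    it uniform on discs away from 0 and from the 1 / n. *)
Lemma cesaro_equation_dominated lam A x y :
  (forall n, 1 <= A%:R * Normc.normc (lam - n.+1%:R^-1)) ->
  cesaro_equation lam x y ->
  polynomially_dominated (A%:R * (1 + A%:R)) A x y.
Proof.
move=> lamA /cesaro_equationP xy.
have A0 : 0 <= A%:R :> R by [].
pose S n : R[i] := \sum_(i < n) x i.
have x_le n : Normc.normc (x n) <=
    A%:R * (Normc.normc (y n) + n.+1%:R^-1 * Normc.normc (S n)).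
  apply: (@le_trans _ _ (A%:R * Normc.normc ((lam - n.+1%:R^-1) * x n))).
    by rewrite Normc.normcM mulrA ler_peMl ?normc_ge0.
  rewrite xy ler_wpM2l//; apply: le_trans (le_normcD _ _) _.
  by rewrite Normc.normcM normc_natV.
have S_le n M : (forall i, (i < n)%N -> Normc.normc (y i) <= M) ->
    Normc.normc (S n) <= A%:R * n%:R * n.+1%:R ^+ A * M.
  elim: n => [|n IH] yM; first by rewrite normc_eq0 /S ?big_ord0// mulr0 !mul0r.
  have M0 : 0 <= M by apply: le_trans (normc_ge0 _) (yM n _).
  have {IH} := IH (fun i ni => yM i (leqW ni)).
  set X := n.+1%:R ^+ A => Sn.
  have t0 : 0 <= n.+1%:R^-1 :> R by rewrite invr_ge0.
  have XX : (1 + A%:R * n.+1%:R^-1) * X <= n.+2%:R ^+ A.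
    apply: le_trans (ler_wpM2r _ (bernoulli_le A t0)) _; first exact: exprn_ge0.
    rewrite -exprMn mulrDl mul1r mulVf ?pnatr_eq0//.
    by rewrite natr1.
  have Y1 : 1 <= n.+2%:R ^+ A :> R by rewrite exprn_ege1// ler1n.
  move: XX Y1; set Y := n.+2%:R ^+ A => XX Y1.
  rewrite {1}/S big_ord_recr/= -/(S n).
  apply: le_trans (le_normcD _ _) _.
  apply: (@le_trans _ _ ((1 + A%:R * n.+1%:R^-1) * Normc.normc (S n) + A%:R * M)).
    rewrite mulrDl mul1r -addrA; apply: lerD => //.
    apply: le_trans (x_le n) _; rewrite mulrDr [leLHS]addrC.
    apply: lerD; first by rewrite mulrA.
    by rewrite ler_wpM2l// yM.
  apply: (@le_trans _ _ (A%:R * n%:R * M * Y + A%:R * M * Y)); last first.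
    by rewrite -natr1; lra.
  apply: lerD; last by rewrite ler_peMr// mulr_ge0.
  apply: (@le_trans _ _ ((1 + A%:R * n.+1%:R^-1) * (A%:R * n%:R * X * M))).
    by rewrite ler_wpM2l// addr_ge0// mulr_ge0.
  rewrite [leLHS](_ : _ = A%:R * n%:R * M * ((1 + A%:R * n.+1%:R^-1) * X)).
    by rewrite ler_wpM2l// !mulr_ge0.
  by ring.
move=> n M yM.
have M0 : 0 <= M by apply: le_trans (normc_ge0 _) (yM n _).
apply: (le_trans (x_le n)).
have {}S_le := S_le n M (fun i ni => yM i (ltnW ni)).
rewrite -!mulrA ler_wpM2l// mulrDl mul1r; apply: lerD.
  by rewrite (le_trans (yM n _))// ler_peMl// exprn_ege1// ler1n.
rewrite ler_pdivrMl// (le_trans S_le)//.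
rewrite -!mulrA [leRHS]mulrCA ler_wpM2l// ler_wpM2r ?mulr_ge0 ?exprn_ge0//.
by rewrite ler_nat.
Qed.

(** The distance from 0 to the numbers 1 / n is 0, but the inverse of the
    operator is explicit: n y_n are, up to sign, the partial sums of x. *)
Lemma cesaro_inverse_dominated x y :
  cesaro_equation 0 x y -> polynomially_dominated 2 1 x y.
Proof.
move=> xy.
pose S n : R[i] := \sum_(i < n) x i.
have SE n : S n.+1 = - (n.+1%:R * y n).
  rewrite -xy mul0r sub0r /cesaro_seq mulrN opprK mulrA.
  by rewrite mulfV ?mul1r// pnatr_eq0.
move=> n M yM; have M0 : 0 <= M by apply: le_trans (normc_ge0 _) (yM n _).
have S_le m : (m <= n.+1)%N -> Normc.normc (S m) <= n.+1%:R * M.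
  case: m => [_|m mn]; first by rewrite normc_eq0 /S ?big_ord0// mulr_ge0.
  rewrite SE normcN Normc.normcM -(rmorph_nat (real_complex R)) normc_real//.
  by rewrite ler_pM ?normc_ge0 ?ler_nat ?yM.
have -> : x n = S n.+1 - S n by rewrite /S big_ord_recr/= addrAC subrr add0r.
apply: le_trans (le_normcD _ _) _; rewrite normcN expr1 -mulrA mulr_natl mulr2n.
by rewrite lerD ?S_le.
Qed.

End estimates.

(** * Resolvents on the power series space *)

Section resolvent.
Context (R : realType) (alpha : nat -> R) (halpha : increasing_to_infty alpha).
Context (walpha : weights_rapidly_decreasing alpha).
Local Notation C := (cesaro_operator halpha).

Lemma cesaro_equationE (lam : R[i]) (x y : Lambda0 alpha) :
  lam *: x - C x = y <-> cesaro_equation lam x y.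
Proof.
split=> [<- //|xy]; apply: Lambda0_eq => n; exact: xy.
Qed.

(** One half of the weight w_k absorbs the polynomial loss, the other half, which
    is a later weight, is left for y. *)
Lemma weight_dominated K B k : 0 <= K -> exists2 c : R, 0 < c &
  forall (x : nat -> R[i]^o) (y : Lambda0 alpha), polynomially_dominated K B x y ->
  forall n, weight alpha k n * Normc.normc (x n) <=
    c * pnorm (2 * k.+1).-1 y.
Proof.
move=> K0; set k' := (2 * k.+1).-1.
have [c c0 cw] := walpha B k'.
exists (c * K + 1) => [|x y xy n]; first by rewrite ltr_wpDl// mulr_ge0.
have w0 := weight_gt0 alpha k' n.
have yM i : (i <= n)%N ->
    Normc.normc (y i) <= pnorm k' y / weight alpha k' n.
  move=> ni; rewrite ler_pdivlMr// mulrC; apply: le_trans (pnorm_ub k' y i).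
  by rewrite ler_wpM2r ?normc_ge0// weight_nonincreasing.
rewrite -(weight_exp alpha k 1) -/k' expr2.
apply: (le_trans (ler_wpM2l _ (xy n _ yM))); first by rewrite mulr_ge0 ?ltW.
set w := weight alpha k' n in w0 *.
rewrite [leLHS](_ : _ = (n.+1%:R ^+ B * w) * (K * pnorm k' y)); last first.
  by field; rewrite gt_eqF.
apply: (@le_trans _ _ (c * K * pnorm k' y)).
  by rewrite -[leRHS]mulrA ler_wpM2r ?mulr_ge0 ?pnorm_ge0// cw.
by rewrite ler_wpM2r ?pnorm_ge0// lerDl.
Qed.

(** Solvability for sequences is all that is needed: the estimate puts the
    solution in the space, makes it unique (take the datum 0), hence linear in
    the datum, and makes it continuous. *)
Lemma resolvent_set_dominated (lam : R[i]) K B : 0 <= K ->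
  (forall y : nat -> R[i]^o, exists x, cesaro_equation lam x y) ->
  (forall x y, cesaro_equation lam x y -> polynomially_dominated K B x y) ->
  resolvent_set C lam.
Proof.
move=> K0 ex dom.
have inj (x x' : Lambda0 alpha) : lam *: x - C x = lam *: x' - C x' -> x = x'.
  move=> xx'; apply/eqP; rewrite -subr_eq0; apply/eqP; apply: Lambda0_eq => n.
  have : lam *: (x - x') - C (x - x') = 0.
    by rewrite scalerBr linearB opprD addrACA xx' -opprD subrr.
  move=> /cesaro_equationE/dom/(_ n 0)/= xx'0.
  apply: Normc.eq0_normc; apply/eqP; rewrite eq_le normc_ge0 andbT.
  by rewrite (le_trans (xx'0 _)) ?mulr0// => i _; rewrite normc_eq0.
have [S SE] : {S : Lambda0 alpha -> Lambda0 alpha &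
    forall y, lam *: S y - C (S y) = y}.
  apply: (choice (P := fun y x => lam *: x - C x = y)) => y; have [x xy] := ex y.
  have xl : x \in Lambda0_pred alpha.
    apply: (Lambda0_of_bounded halpha) => k; have [c c0 cP] := weight_dominated B k K0.
    by exists (c * pnorm (2 * k.+1).-1 y) => n; apply: cP; exact: dom.
  by exists (MkLambda0 xl); apply/cesaro_equationE.
have S_lin : linear S.
  move=> a y z; apply: inj; rewrite SE [C _]linearP scalerDr opprD addrACA SE.
  by rewrite scalerA mulrC -scalerA -scalerBr SE.
pose SL := GRing.isLinear.Build _ _ _ _ S S_lin.
pose SL' : {linear Lambda0 alpha -> Lambda0 alpha} := HB.pack S SL.
have S_cont : continuous SL'.
  move=> y; have Fy : Filter (nbhs y) by exact: nbhs_filter.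
  apply: (@Lambda0_cvgP _ _ (SL' @ y) _ (SL' y)) => k e e0.
  have [c c0 cP] := weight_dominated B k K0.
  have ec : 0 < e / c by rewrite divr_gt0.
  apply: filterS (near_pnorm y (2 * k.+1).-1 ec) => z zy.
  suff : pnorm k (SL' (z - y)) < e by rewrite (linearB SL').
  apply: (@le_lt_trans _ _ (c * pnorm (2 * k.+1).-1 (z - y))).
    by apply: pnorm_le => n; apply: cP; apply/dom/cesaro_equationE; exact: SE.
  by rewrite mulrC -ltr_pdivlMr.
exists (ContinuousOperator S_cont); split=> [x|y]; last exact: SE.
by apply: inj; exact: SE.
Qed.

Lemma equicontinuous_resolvents (D : set R[i]) K B : 0 <= K ->
  (forall lam, D lam -> forall x y, cesaro_equation lam x y ->
    polynomially_dominated K B x y) ->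
  equicontinuous_operators
    [set S | exists2 lam, D lam & is_resolvent C lam S].
Proof.
move=> K0 dom V [k [e [e0 kV]]].
have [c c0 cP] := weight_dominated B k K0.
have ec : 0 < e / c by rewrite divr_gt0.
exists (Lambda0_ball (0 : Lambda0 alpha) (2 * k.+1).-1 (e / c)).
  by exists (2 * k.+1).-1, (e / c); split.
move=> S [lam Dlam [_ SE]] _ [y y_small <-]; apply: kV => j jk.
have := y_small _ (leqnn _); rewrite !subr0 => {}y_small.
apply: le_lt_trans (pnorm_ndecr halpha _ jk) _.
apply: (@le_lt_trans _ _ (c * pnorm (2 * k.+1).-1 y)).
  apply: pnorm_le => n; apply: cP; apply: (dom _ Dlam).
  by apply/cesaro_equationE; exact: SE.
by rewrite mulrC -ltr_pdivlMr.
Qed.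

End resolvent.

(** * The spectra *)

Section spectra.
Context (R : realType).

Lemma point_spectrum_sub (E : tvsType R[i]) (T : continuous_operator E) :
  point_spectrum T `<=` spectrum T.
Proof.
by move=> lam ninj [S [SK _]]; apply: ninj; exact: (can_inj SK).
Qed.

Lemma closure_spectrum_sub (E : tvsType R[i]) (T : continuous_operator E) :
  closure (spectrum T) `<=` spectrum_star T.
Proof.
move=> lam lam_cl [d [d0 dT _]].
by have [mu [mu_sp /dT]] := lam_cl _ (nbhsx_ballx lam d d0).
Qed.

Lemma inv_nat_lt (e : R) : 0 < e -> exists N, forall n, (N <= n)%N ->
  n.+1%:R^-1 < e.
Proof.
move=> e0; have /cvgrPdist_lt/(_ _ e0)[N _ HN] := @cvg_harmonic R.
by exists N => n /HN; rewrite /= sub0r normrN gtr0_norm.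
Qed.

(** Only finitely many of the numbers 1 / n are near a nonzero lam, and lam
    differs from each of them. *)
Lemma Sigma0_gap (lam : R[i]) : ~ Sigma0 R lam -> exists2 r : R, 0 < r &
  forall n, r <= Normc.normc (lam - n.+1%:R^-1).
Proof.
move=> lamS.
have lam0 : 0 < Normc.normc lam.
  rewrite lt_neqAle normc_ge0 andbT eq_sym; apply/eqP => /Normc.eq0_normc l0.
  by apply: lamS; left.
have [N HN] := inv_nat_lt (divr_gt0 lam0 (ltr0n _ 2)).
suff [r r0 rN] : exists2 r : R, 0 < r & forall n, (n < N)%N ->
    r <= Normc.normc (lam - n.+1%:R^-1).
  exists (Num.min r (Normc.normc lam / 2)); first by rewrite lt_min r0 divr_gt0.
  move=> n; rewrite ge_min; have [/rN -> //|/HN nlam] := ltnP n N.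
  apply/orP; right.
  have : Normc.normc lam <= Normc.normc (lam - n.+1%:R^-1) + n.+1%:R^-1.
    by rewrite -{1}(subrK n.+1%:R^-1 lam) -[in leRHS]normc_natV le_normcD.
  move: nlam; set a := Normc.normc lam; set b := Normc.normc (lam - _).
  by set t : R := n.+1%:R^-1; lra.
elim: N {HN} => [|N [r r0 rN]]; first by exists 1.
exists (Num.min r (Normc.normc (lam - N.+1%:R^-1))).
  rewrite lt_min r0 lt_neqAle normc_ge0 andbT eq_sym; apply/eqP.
  move=> /Normc.eq0_normc/eqP; rewrite subr_eq0 => /eqP lamN.
  by apply: lamS; right; exists N.
move=> n; rewrite ltnS leq_eqVlt ge_min => /orP[/eqP ->|/rN ->//].
by rewrite lexx orbT.
Qed.

Lemma closure_Sigma : closure (Sigma R) = Sigma0 R.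
Proof.
apply/seteqP; split=> [lam lam_cl|lam [->|lamS]]; last exact: subset_closure.
  apply: contrapT => /Sigma0_gap[r r0 rP].
  have [mu [[n _ muE]]] := lam_cl _ (near_normc lam r0).
  by rewrite -muE /= -normcN opprB ltNge rP.
move=> U /nbhs_ballP[e /= e0 eU].
have Re_e0 : 0 < complex.Re e by move: e0; rewrite ltcE => /andP[].
have [N HN] := inv_nat_lt Re_e0.
exists (N.+1%:R^-1); split; first by exists N.
apply: eU; rewrite -ball_normE /= sub0r normrN.
rewrite -[e]RRe_real ?gtr0_real// ltcR normc_natV; exact: HN.
Qed.

Lemma bin_le_exp n m : ('C(n, m) <= n.+1 ^ m)%N.
Proof.
elim: n m => [|n IH] [|m]; rewrite ?bin0 ?expn0// binS.
rewrite (leq_trans (leq_add (IH m.+1) (IH m)))// expnS -mulSnr expnS.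
by rewrite leq_mul//; case: m => // m; rewrite leq_exp2r.
Qed.

Lemma sum_bin_col n m : (\sum_(i < n) 'C(i, m) = 'C(n, m.+1))%N.
Proof.
by elim: n => [|n IH]; rewrite ?big_ord0// big_ord_recr/= IH binS.
Qed.

(** The sequence of the binomial coefficients in a fixed column is an eigenvector
    of the averaging map: their sums form the next column. *)
Lemma cesaro_seq_bin m n :
  cesaro_seq (fun i => 'C(i, m)%:R : R[i]^o) n = m.+1%:R^-1 * 'C(n, m)%:R :> R[i].
Proof.
rewrite /cesaro_seq -natr_sum sum_bin_col.
apply: (@mulfI _ (m.+1%:R * n.+1%:R)); first by rewrite mulf_neq0 ?pnatr_eq0.
rewrite -mulrA mulVKf ?pnatr_eq0// mulrAC -mulrA mulrA mulrC mulrA mulrAC.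
rewrite mulfV ?pnatr_eq0// mul1r mulrC -!natrM.
by congr _%:R; rewrite mul_bin_diag.
Qed.

Section cesaro.
Context (alpha : nat -> R) (halpha : increasing_to_infty alpha).
Context (walpha : weights_rapidly_decreasing alpha).
Local Notation C := (cesaro_operator halpha).

(** The eigenvectors have polynomial growth, so they belong to the space. *)
Lemma Sigma_sub_point_spectrum : Sigma R `<=` point_spectrum C.
Proof.
move=> _ [m _ <-] inj.
have xl : (fun n => 'C(n, m)%:R : R[i]^o) \in Lambda0_pred alpha.
  apply: (Lambda0_of_bounded halpha) => k; have [K _ HK] := walpha m k.
  exists K => n; apply: le_trans (HK n); rewrite mulrC ler_wpM2r//.
    exact/ltW/weight_gt0.
  by rewrite -(rmorph_nat (real_complex R)) normc_real// -natrX ler_nat bin_le_exp.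
have /inj : (m.+1%:R^-1 : R[i]) *: MkLambda0 xl - C (MkLambda0 xl) =
    (m.+1%:R^-1 : R[i]) *: 0 - C 0.
  rewrite scaler0 linear0 subr0; apply/cesaro_equationE => n.
  by rewrite cesaro_seq_bin subrr.
move=> /(congr1 (fun z : Lambda0 alpha => z m : R[i]))/eqP.
by rewrite /= binn oner_eq0.
Qed.

Lemma compl_Sigma_resolvent : ~` Sigma R `<=` resolvent_set C.
Proof.
move=> lam lamS.
have lam_neq n : lam - n.+1%:R^-1 != 0.
  by rewrite subr_eq0; apply: contra_notN lamS => /eqP ->; exists n.
have ex y := cesaro_equation_solvable y lam_neq.
have [lam0|lam0] := eqVneq lam 0.
  apply: (@resolvent_set_dominated _ _ halpha walpha _ 2 1) => // x y.
  by rewrite lam0; exact: cesaro_inverse_dominated.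
have [|r r0 rP] := @Sigma0_gap lam; first by case=> [/eqP|//]; rewrite (negbTE lam0).
have [A rA] : exists A : nat, r^-1 <= A%:R.
  by exists (Num.bound r^-1); rewrite ltW// archi_boundP// invr_ge0 ltW.
apply: (@resolvent_set_dominated _ _ halpha walpha _ (A%:R * (1 + A%:R)) A) => // x y.
apply: cesaro_equation_dominated => n.
by rewrite -[leLHS](mulVf (lt0r_neq0 r0)) ler_pM ?invr_ge0 ?(ltW r0).
Qed.

(** On a small disc around lam, the distance to the numbers 1 / n has a common
    lower bound, so all the resolvents obey the same estimate. *)
Lemma compl_Sigma0_resolvent_star : ~` Sigma0 R `<=` resolvent_set_star C.
Proof.
move=> lam /Sigma0_gap[r r0 rP].
have r20 : 0 < r / 2 by rewrite divr_gt0.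
have near_gap mu : ball lam ((r / 2)%:C) mu ->
    forall n, r / 2 <= Normc.normc (mu - n.+1%:R^-1).
  rewrite -ball_normE/= ltcR => lam_mu n; have := rP n.
  rewrite -(subrKA mu) => /le_trans/(_ (le_normcD _ _)).
  by lra.
exists ((r / 2)%:C); split; first by rewrite ltcR.
- move=> mu /near_gap gap; apply: compl_Sigma_resolvent => -[n _ mun].
  by have := gap n; rewrite mun subrr (Normc.normc0 R) leNgt r20.
- have [A rA] : exists A : nat, (r / 2)^-1 <= A%:R.
    by exists (Num.bound (r / 2)^-1); rewrite ltW// archi_boundP// invr_ge0 ltW.
  apply: (@equicontinuous_resolvents _ _ halpha walpha _ (A%:R * (1 + A%:R)) A).
    by rewrite mulr_ge0// addr_ge0.
  move=> mu /near_gap gap x y; apply: cesaro_equation_dominated => n.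
  by rewrite -[leLHS](mulVf (lt0r_neq0 r20)) ler_pM ?invr_ge0 ?(ltW r20)// gap.
Qed.

End cesaro.
End spectra.

Unset Implicit Arguments.
Local Close Scope complex_scope.

Theorem proposition2p12 (R : realType) (alpha : nat -> R)
    (halpha : increasing_to_infty alpha) :
  (nuclear_space (Lambda0 alpha) ->
     spectrum (cesaro_operator halpha) = point_spectrum (cesaro_operator halpha) /\
     point_spectrum (cesaro_operator halpha) = Sigma R) /\
  (nuclear_space (Lambda0 alpha) -> 0 < min_gap alpha ->
     spectrum_star (cesaro_operator halpha) =
       closure (spectrum (cesaro_operator halpha)) /\
     closure (spectrum (cesaro_operator halpha)) = Sigma0 R).
Proof.
have sp_sub : nuclear_space (Lambda0 alpha) ->
    spectrum (cesaro_operator halpha) `<=` Sigma R.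
  move=> /(nuclear_weights halpha) walpha lam lam_sp; apply: contrapT => lamS.
  by apply: lam_sp; exact: compl_Sigma_resolvent.
have spE : nuclear_space (Lambda0 alpha) ->
    spectrum (cesaro_operator halpha) = Sigma R.
  move=> nE; apply/seteqP; split; first exact: sp_sub.
  apply: subset_trans (@point_spectrum_sub _ _ _).
  exact: Sigma_sub_point_spectrum (nuclear_weights halpha nE).
split=> [nE|nE _].
  suff ptE : point_spectrum (cesaro_operator halpha) = Sigma R by rewrite spE.
  apply/seteqP; split; last first.
    exact: Sigma_sub_point_spectrum (nuclear_weights halpha nE).
  exact: subset_trans (@point_spectrum_sub _ _ _) (sp_sub nE).
have clE : closure (spectrum (cesaro_operator halpha)) = Sigma0 R.
  by rewrite spE// closure_Sigma.
split=> //; apply/seteqP; split; last exact: closure_spectrum_sub.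
rewrite clE => lam lam_sp; apply: contrapT => lamS; apply: lam_sp.
exact: compl_Sigma0_resolvent_star (nuclear_weights halpha nE) _ lamS.
Qed.
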